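(* Let $k$ be a positive integer, $F=\{1,2,\dots,k\}$ and $\mathfrak{p}_F(x)=\prod_{j\in F}(x-j)$. Let $a,c$ be real numbers with $a\neq 0,1$, $c\neq 0,-1,-2,\dots$, and $$m_k^{a,-c-k+1}(-n)\neq 0\quad\text{for all } n\ge 1,$$ where $m_k^{a,-c-k+1}$ is a Meixner polynomial. Then the orthogonal polynomials $(q_n)_{n\ge 0}$ with respect to $\mathfrak{p}_F\,\rho_{a,c}$, where $\rho_{a,c}$ is the moment functional for the Meixner polynomials $(m_n^{a,c})_n$, are common eigenfunctions of a difference operator of order $2k+2$ and genre $(-k-1,k+1)$; that is, there are such an operator $D$ and numbers $\lambda_n$ with $D(q_n)=\lambda_nq_n$ for all $n\ge 0$.
   Context: For $l\in\mathbb{Z}$ the shift operator $\mathfrak{s}_l$ acts on polynomials by $\mathfrak{s}_l(f)(x)=f(x+l)$. A finite difference operator $\sum_{l=s}^r f_l\,\mathfrak{s}_l$ (with polynomial coefficients $f_l$ independent of $n$) with $f_s,f_r\neq 0$ has order $r-s$ and genre $(s,r)$. Meixner polynomials (for $a\neq 0,1$ and any real $c$): $m_n^{a,c}(x)=(-1)^n\sum_{j=0}^na^{-j}\binom{x}{j}\binom{-x-c}{n-j}$. A moment functional is a linear map $\mu:\mathbb{P}\to\mathbb{R}$ on the space $\mathbb{P}$ of real polynomials; for a polynomial $r$, $\langle r\mu,p\rangle=\langle\mu,rp\rangle$. For $a\neq 0,1$ and $c\neq 0,-1,-2,\dots$, the Meixner moment functional $\rho_{a,c}$ is the unique moment functional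 with respect to which $(m_n^{a,c})_n$ are orthogonal, normalized by $\langle\rho_{a,c},1\rangle=\Gamma(c)$ (for $0<|a|<1$ it is given by the measure $(1-a)^c\sum_{x=0}^\infty\frac{a^x\Gamma(x+c)}{x!}\delta_x$). Orthogonal polynomials with respect to $\mu$ are polynomials $(q_n)_n$ with $\deg q_n=n$, $\langle\mu,q_nx^m\rangle=0$ for $0\le m<n$ and $\langle\mu,q_nx^n\rangle\neq 0$ (each $q_n$ is unique up to a nonzero constant factor). *)

(* Defs.v *)
From HB Require Import structures.
From mathcomp Require Import all_boot all_order all_algebra.
From mathcomp Require Import all_classical all_reals all_analysis.

Set Implicit Arguments.
Unset Strict Implicit.
Unset Printing Implicit Defensive.

Import Order.TTheory GRing.Theory Num.Theory.
Import numFieldNormedType.Exports.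

Local Open Scope classical_set_scope.
Local Open Scope ring_scope.

(* The Gamma function on R minus {0, -1, -2, ...}, by the Gauss limit
   lim_n n! n^x / (x (x + 1) ... (x + n)); unlike the Euler integral, it covers
   negative non-integers without analytic continuation. *)
Definition Gamma (R : realType) (x : R) : R :=
  lim ((fun n : nat =>
    n`!%:R * n%:R `^ x / \prod_(i < n.+1) (x + i%:R)) @ \oo).

(* The generalized binomial coefficient p (p - 1) ... (p - j + 1) / j!,
   where p is a polynomial. *)
Definition binp (R : fieldType) (p : {poly R}) (j : nat) : {poly R} :=
  (j`!%:R)^-1 *: \prod_(i < j) (p - i%:R%:P).

Definition meixner (R : fieldType) (a c : R) (n : nat) : {poly R} :=
  (-1) ^+ n *: \sum_(j < n.+1) a ^- j *: (binp 'X j * binp (- 'X - c%:P) (n - j)).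

Definition shift_op (R : nzRingType) (l : int) (p : {poly R}) : {poly R} :=
  p \Po ('X + (l%:~R)%:P).

Definition is_diffop_of_genre (R : nzRingType) (D : {poly R} -> {poly R})
    (s r : int) : Prop :=
  s <= r /\
  exists f : int -> {poly R},
    [/\ f s != 0, f r != 0 &
        forall p, D p = \sum_(i < `|r - s|%N.+1)
                          f (s + i%:Z) * shift_op (s + i%:Z) p].

Definition is_diffop_of_order (R : nzRingType) (D : {poly R} -> {poly R})
    (m : nat) : Prop :=
  exists s r : int, is_diffop_of_genre D s r /\ r - s = m%:Z.

(* Moment functionals are elements of {scalar {poly R}}; this is r mu. *)
Definition mul_functional (R : comNzRingType) (r : {poly R})
  (mu : {scalar {poly R}}) (p : {poly R}) : R := mu (r * p).

Fact mul_functional_is_linear (R : comNzRingType) (r : {poly R})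
  (mu : {scalar {poly R}}) : scalar (mul_functional r mu).
Proof.
by move=> a p q; rewrite /mul_functional mulrDr -scalerAr linearP.
Qed.

HB.instance Definition _ (R : comNzRingType) (r : {poly R})
    (mu : {scalar {poly R}}) :=
  GRing.isLinear.Build R {poly R} R *%R (mul_functional r mu)
    (mul_functional_is_linear r mu).

Definition is_orthogonal_polys (R : comNzRingType) (mu : {scalar {poly R}})
    (q : nat -> {poly R}) : Prop :=
  forall n : nat,
    [/\ size (q n) = n.+1,
        forall m : nat, (m < n)%N -> mu (q n * 'X^m) = 0 &
        mu (q n * 'X^n) != 0].

(* These two conditions determine rho uniquely when a is not 0 or 1 and c is not
   0, -1, -2, ...  *)
Definition is_meixner_functional (R : realType) (a c : R)
    (rho : {scalar {poly R}}) : Prop :=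
  is_orthogonal_polys rho (meixner a c) /\ rho 1 = Gamma c.

Definition pF (R : nzRingType) (F : seq nat) : {poly R} :=
  \prod_(j <- F) ('X - j%:R%:P).
Arguments pF : clear implicits.

(* Main.v *)
From HB Require Import structures.
Require Import Defs.
From mathcomp Require Import all_boot all_order all_algebra.
From mathcomp Require Import all_classical all_reals all_analysis.
From mathcomp Require Import ring zify.

Set Implicit Arguments.
Unset Strict Implicit.
Unset Printing Implicit Defensive.

Import Order.TTheory GRing.Theory Num.Theory.

Local Open Scope ring_scope.

(** Write rho for the Meixner functional and mu for p_F rho.  Since
X p_F = X (X - 1) ... (X - k), the Pearson equation
a rho((X + c) p(X + 1)) = rho(X p) turns X mu into a translate by k + 1 of the
Meixner functional of parameter c + k + 1, so mu is a Geronimus transform of a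
Meixner functional: the polynomials P_n(x) = m_n^{a,c+k+1}(x - k - 1) are
orthogonal for X mu, and an orthogonal polynomial for mu is a combination of
P_n and P_{n-1} which is, for n > 0, moreover killed by mu.

The combination is explicit because the numbers mu(P_n) are: the contiguity
relations of the Meixner polynomials give a recurrence in k and n whose
solution is mu(P_n) = C a^{-n} Y(n), where C is a nonzero constant and
Y(n) = m_k^{a,-c-k+1}(-n-1) is a polynomial in n
([mass_translated_meixner]).  Hence
Q_n = Y(n-1) P_n - a^{-1} Y(n) P_{n-1} is orthogonal for mu
([krall_meixner_orth]); the hypotheses on m_k^{a,-c-k+1} and c make
all the numbers Y(n), n >= -1, nonzero, so Q_n has degree n and nonzero norm.

For the operator, let N be the translated second-order Meixner operator, with
N P_n = n P_n, and let E = (s_{-1} - a) / (1 - a).  The contiguity relations say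
that E undoes the lowering: E (P_n - a^{-1} P_{n-1}) = P_n.  As Y(N) Q_n is
Y(n) Y(n-1) (P_n - a^{-1} P_{n-1}), it follows that
E Y(N) Q_n = Y(n) Y(n-1) P_n.  Take a polynomial G with
G(n-1) - G(n) = Y(n); then
(G(N) + E Y(N)) Q_n = Y(n-1) (G(n) + Y(n)) P_n - a^{-1} Y(n) G(n-1) P_{n-1}
= G(n-1) Q_n.
Such a G is a / (a - 1) m_{k+1}^{a,-c-k}(-n-1), of degree k + 1.  So G(N) has
genre (-k-1, k+1), while E Y(N) contributes nothing to the shift by k + 1, and
to the shift by -k-1 only a coefficient of degree k, too small to cancel the
one of degree k + 1 in G(N) ([krall_operator]).  Orthogonal polynomials being unique up
to constant factors, the operator works for every orthogonal family. *)

(** * Shifts and forward differences *)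

Section Shift.
Variable R : comNzRingType.
Implicit Types (p q : {poly R}) (l m : int).

Fact shift_op_is_linear l : linear (@shift_op R l).
Proof. by move=> x p q; rewrite /shift_op comp_polyD comp_polyZ. Qed.
HB.instance Definition _ l :=
  GRing.isLinear.Build R {poly R} {poly R} *:%R (@shift_op R l) (shift_op_is_linear l).

Lemma shift_opD l p q : shift_op l (p + q) = shift_op l p + shift_op l q.
Proof. exact: linearD. Qed.

Lemma shift_opB l p q : shift_op l (p - q) = shift_op l p - shift_op l q.
Proof. exact: linearB. Qed.

Lemma shift_opZ l (x : R) p : shift_op l (x *: p) = x *: shift_op l p.
Proof. exact: linearZ. Qed.

Lemma shift_opM l p q : shift_op l (p * q) = shift_op l p * shift_op l q.
Proof. exact: comp_polyM. Qed.

Lemma shift_opX l : shift_op l 'X = 'X + (l%:~R)%:P :> {poly R}.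
Proof. exact: comp_polyX. Qed.

Lemma shift_opC l (x : R) : shift_op l x%:P = x%:P.
Proof. exact: comp_polyC. Qed.

Lemma shift_opA l m p : shift_op l (shift_op m p) = shift_op (l + m) p.
Proof.
rewrite /shift_op -comp_polyA comp_polyD comp_polyX comp_polyC.
by rewrite -addrA -polyCD intrD.
Qed.

Lemma shift_op0 p : shift_op 0 p = p.
Proof. by rewrite /shift_op addr0 comp_polyXr. Qed.

Lemma horner_shift_op l p x : (shift_op l p).[x] = p.[x + l%:~R].
Proof. by rewrite /shift_op horner_comp hornerD hornerX hornerC. Qed.

End Shift.

Section ShiftSize.
Variable R : numFieldType.
Implicit Types (p : {poly R}) (l : int).

Lemma size_shift_op l p : size (shift_op l p) = size p.
Proof. by rewrite /shift_op size_comp_poly2 // size_XaddC. Qed.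

(** The bound alone does not determine the degree of the difference, so the
induction also carries its top coefficient, which comes from
(x + 1)^{n+1} - x^{n+1} = (n + 1) x^n + ... *)
Lemma size_forward_difference_le n p : (size p <= n.+2)%N ->
  (size (shift_op 1 p - p)%R <= n.+1)%N /\
  (shift_op 1 p - p)`_n = n.+1%:R * p`_n.+1.
Proof.
elim: n p => [|n IH] p.
  elim/poly_ind: p => [|p x _] sp; first by rewrite linear0 subr0 size_poly0 !coef0 mulr0.
  have {}sp : (size p <= 1)%N.
    move: sp; rewrite size_MXaddC; case: eqP => [-> /=|_ //]; by rewrite size_poly0.
  rewrite (size1_polyC sp) shift_opD shift_opM shift_opX !shift_opC.
  have -> : (p`_0)%:P * ('X + 1%:~R%:P) + x%:P - ((p`_0)%:P * 'X + x%:P) = (p`_0)%:P.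
    by rewrite mulrDr mulr1z polyC1 mulr1; ring.
  by rewrite size_polyC_leq1 coefD coefMX !coefC /= addr0 mul1r.
elim/poly_ind: p => [|p x _] sp; first by rewrite linear0 subr0 size_poly0 !coef0 mulr0.
have {}sp : (size p <= n.+2)%N.
  move: sp; rewrite size_MXaddC; case: eqP => [-> /=|_ //]; by rewrite size_poly0.
have [s1 s2] := IH p sp.
rewrite shift_opD shift_opM shift_opX !shift_opC mulr1z polyC1.
have -> : shift_op 1 p * ('X + 1) + x%:P - (p * 'X + x%:P)
   = (shift_op 1 p - p) * 'X + (shift_op 1 p - p) + p by ring.
move: (shift_op 1 p - p) s1 s2 => d s1 s2; split.
  apply: (leq_trans (size_polyD _ _)); rewrite geq_max sp andbT.
  apply: (leq_trans (size_polyD _ _)); rewrite geq_max (leq_trans s1) // andbT.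
  apply: (leq_trans (size_polyMleq _ _)); rewrite size_polyX addn2 /=; exact: s1.
rewrite !coefD !coefMX coefC /= s2 (nth_default 0 s1) !addr0.
by rewrite -[n.+2]addn1 natrD mulrDl mul1r.
Qed.

Lemma size_forward_difference p : size (shift_op 1 p - p) = (size p).-1.
Proof.
case E: (size p) => [|[|n]] /=.
- by move/eqP: E; rewrite size_poly_eq0 => /eqP->; rewrite linear0 subr0 size_poly0.
- by rewrite (size1_polyC (eq_leq E)) shift_opC subrr size_poly0.
have [s1 s2] := size_forward_difference_le (eq_leq E).
apply/eqP; rewrite eqn_leq s1 ltnNge; apply/negP => s3.
have : lead_coef p == 0.
  have := s2; rewrite (nth_default 0 s3) => /esym /eqP.
  by rewrite mulf_eq0 pnatr_eq0 /= lead_coefE E.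
by rewrite lead_coef_eq0 -size_poly_eq0 E.
Qed.

End ShiftSize.

(** * Convolutions of binomial coefficients *)

Section Binomial.
Variable R : numFieldType.
Implicit Types (p q : {poly R}) (s t : R).

Lemma binp0 p : binp p 0 = 1.
Proof. by rewrite /binp big_ord0 invr1 scale1r. Qed.

Lemma binpS p j : j.+1%:R *: binp p j.+1 = p * binp (p - 1) j.
Proof.
rewrite /binp scalerA factS natrM invfM mulrA divff ?pnatr_eq0 // mul1r.
rewrite -scalerAr big_ord_recl subr0; congr (_ *: (_ * _)).
apply: eq_bigr => i _; rewrite /= /bump /= natrD polyCD opprD addrA //.
Qed.

Lemma binpSr p j : j.+1%:R *: binp p j.+1 = (p - j%:R%:P) * binp p j.
Proof.
rewrite /binp scalerA factS natrM invfM mulrA divff ?pnatr_eq0 // mul1r.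
by rewrite -scalerAr big_ord_recr mulrC.
Qed.

Lemma binp_pascal p j : binp (p + 1) j.+1 = binp p j.+1 + binp p j.
Proof.
have j0 : j.+1%:R != 0 :> R by rewrite pnatr_eq0.
apply: (scalerI j0); rewrite scalerDr binpS addrK binpSr -mul_polyC.
by rewrite -natr1 polyCD -mulrDl addrA subrK.
Qed.

Lemma shift_binp l p j : shift_op l (binp p j) = binp (shift_op l p) j.
Proof.
rewrite /binp linearZ /=; congr (_ *: _).
rewrite /shift_op rmorph_prod; apply: eq_bigr => i _.
by rewrite rmorphB /= comp_polyC.
Qed.

(** The coefficient of z^n in (1 + s z)^p (1 + t z)^q.  In this two-parameter form
the roles of p and q can be exchanged, and each identity below needs a proof in
one of the two factors only. *)
Definition binconv s t p q n : {poly R} :=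
  \sum_(j < n.+1) (s ^+ j * t ^+ (n - j)) *: (binp p j * binp q (n - j)).

Lemma binconvC s t p q n : binconv s t p q n = binconv t s q p n.
Proof.
rewrite /binconv (reindex_inj rev_ord_inj) /=; apply: eq_bigr => i _.
have ile : (i <= n)%N by rewrite -ltnS.
by rewrite subSS subKn // [s ^+ _ * _]mulrC [binp p _ * _]mulrC.
Qed.

(** Multiplication of the generating function by 1 + s z. *)
Lemma binconv_pascal s t p q n :
  binconv s t (p + 1) q n.+1 = binconv s t p q n.+1 + s *: binconv s t p q n.
Proof.
rewrite /binconv ![\sum_(i < n.+2) _]big_ord_recl /= !binp0 -addrA; congr (_ + _).
rewrite scaler_sumr -big_split; apply: eq_bigr => i _ /=.
by rewrite /bump /= add1n binp_pascal mulrDl scalerDr subSS scalerA exprS -mulrA.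
Qed.

(** Differentiation of the generating function in z: the derivative of
(1 + s z)^p is s p (1 + s z)^{p-1}. *)
Lemma binconv_absorb s t p q n :
  n.+1%:R *: binconv s t p q n.+1 =
  s *: (p * binconv s t (p - 1) q n) + t *: (q * binconv s t p (q - 1) n).
Proof.
(* the part of the sum coming from the derivative of the first factor *)
have half s' t' p' q' : s' *: (p' * binconv s' t' (p' - 1) q' n) =
    \sum_(j < n.+2) j%:R *: ((s' ^+ j * t' ^+ (n.+1 - j)) *: (binp p' j * binp q' (n.+1 - j))).
  rewrite big_ord_recl scale0r add0r mulr_sumr scaler_sumr; apply: eq_bigr => i _.
  rewrite /= /bump add1n subSS.
  move: (binpS p' i); move: (binp p' _) (binp (p' - 1) _) (binp q' _) => x y z xy.
  rewrite -!scalerAr !scalerA [_.+1%:R * _]mulrC -[in RHS]scalerA [in RHS]scalerAl xy.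
  by rewrite exprS !mulrA.
rewrite half binconvC.
rewrite -[in RHS]/(_ + t *: (q * _)) [binconv s t p (q - 1) n]binconvC half binconvC.
rewrite [X in _ + X](reindex_inj rev_ord_inj) -big_split scaler_sumr /=.
apply: eq_bigr => i _; have ile : (i <= n.+1)%N by rewrite -ltnS.
rewrite subSS subKn // [t ^+ _ * _]mulrC [binp q _ * _]mulrC -scalerDl.
by rewrite -natrD subnKC.
Qed.

End Binomial.

(** * Contiguity relations of the Meixner polynomials *)

Section Meixner.
Variables (R : numFieldType) (a : R).
Hypotheses (ha0 : a != 0) (ha1 : a != 1).
Implicit Types (c : R) (n : nat).

(** The generating function of the Meixner polynomials is
(1 - z / a)^x (1 - z)^{-x-c}; the relations below are its images under
differentiation and under multiplication by 1 - z / a or 1 - z. *)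
Lemma meixnerE c n : meixner a c n = binconv (- a^-1) (-1) 'X (- 'X - c%:P) n.
Proof.
rewrite /meixner /binconv scaler_sumr; apply: eq_bigr => i _.
have ile : (i <= n)%N by rewrite -ltnS.
rewrite scalerA; congr (_ *: _).
rewrite -{1}(subnKC ile) exprD [in RHS]exprNn exprVn.
by rewrite mulrAC.
Qed.

Lemma meixner0 c : meixner a c 0 = 1.
Proof. by rewrite meixnerE /binconv big_ord1 !expr0 mul1r scale1r !binp0 mulr1. Qed.

Lemma shift_meixner l c n : shift_op l (meixner a c n) =
  binconv (- a^-1) (-1) ('X + (l%:~R)%:P) (- 'X - (l%:~R + c)%:P) n.
Proof.
rewrite meixnerE /binconv linear_sum; apply: eq_bigr => i _ /=.
rewrite shift_opZ shift_opM !shift_binp shift_opX shift_opB raddfN /= shift_opX shift_opC.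
by rewrite polyCD !opprD addrA.
Qed.

Lemma meixner_raise c n : n.+1%:R *: meixner a c n.+1 =
  ('X + c%:P) * meixner a (c + 1) n - a^-1 *: ('X * shift_op (-1) (meixner a (c + 1) n)).
Proof.
rewrite shift_meixner meixnerE binconv_absorb [meixner _ _ _]meixnerE addrC.
have -> : (-1)%:~R + (c + 1) = c by rewrite mulrN1z addrC addrK.
rewrite polyCD; congr (_ + _).
  by rewrite scaleN1r -mulNr opprD !opprK [in RHS]opprD addrA.
by rewrite scaleNr mulrN1z polyCN.
Qed.

Lemma meixner_pascal_r c n :
  meixner a c n.+1 = meixner a (c + 1) n.+1 - meixner a (c + 1) n.
Proof.
rewrite !meixnerE.
have -> : - 'X - c%:P = (- 'X - (c + 1)%:P) + 1 :> {poly R} by rewrite polyCD; ring.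
by rewrite binconvC binconv_pascal scaleN1r ![binconv (-1) _ _ _ _]binconvC.
Qed.

Lemma meixner_pascal_l c n : shift_op 1 (meixner a c n.+1) =
  meixner a (c + 1) n.+1 - a^-1 *: meixner a (c + 1) n.
Proof.
by rewrite shift_meixner !meixnerE mulr1z binconv_pascal scaleNr addrC [1 + c]addrC addrC.
Qed.

Lemma meixner_forward c n : shift_op 1 (meixner a c n.+1) - meixner a c n.+1 =
  (1 - a^-1) *: meixner a (c + 1) n.
Proof.
by rewrite meixner_pascal_l [meixner a c _]meixner_pascal_r scalerBl scale1r; ring.
Qed.

Lemma subr1V_neq0 : 1 - a^-1 != 0.
Proof. by rewrite subr_eq0 eq_sym invr_eq1. Qed.

(** The forward difference lowers the degree by exactly one and sends m_{n+1}
to a nonzero multiple of m_n, whence an induction on n for all c at once. *)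
Lemma size_meixner c n : size (meixner a c n) = n.+1.
Proof.
elim: n c => [|n IH] c; first by rewrite meixner0 size_poly1.
have := size_forward_difference (meixner a c n.+1).
rewrite meixner_forward size_scale ?subr1V_neq0 // IH.
by case: (size _) => //= m <-.
Qed.

(** Lowering by the forward difference and then raising returns to m_n with the
factor n. *)
Lemma meixner_eigen c n :
  ('X + c%:P) * (a *: (shift_op 1 (meixner a c n) - meixner a c n))
    - 'X * (meixner a c n - shift_op (-1) (meixner a c n))
  = ((a - 1) * n%:R) *: meixner a c n.
Proof.
case: n => [|n].
  by rewrite meixner0 -polyC1 !shift_opC !subrr scaler0 !mulr0 scale0r subr0.
have E := meixner_forward c n.
have /(congr1 (shift_op (-1))) := E; rewrite shift_opB shift_opA addNr shift_op0 [RHS]shift_opZ => ->.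
rewrite E -scalerA meixner_raise; move: (meixner a (c + 1) n) => p.
rewrite -!scalerAr scalerBr !scalerA.
have -> : a * (1 - a^-1) = a - 1 by field.
by have -> : (a - 1) * a^-1 = 1 - a^-1 by field.
Qed.

Lemma meixner_at0 c n : n.+1%:R * (meixner a c n.+1).[0] = c * (meixner a (c + 1) n).[0].
Proof.
rewrite -hornerZ meixner_raise; move: (meixner a (c + 1) n) => p.
by rewrite hornerD hornerN hornerZ !hornerM hornerD hornerX hornerC !mul0r mulr0 subr0 add0r.
Qed.

End Meixner.

(** * The Pearson equation *)

(** An induction principle standing for the fact that a sequence of polynomials
of degrees 0, 1, 2, ... is a basis. *)
Lemma poly_basis_ind (R : fieldType) (b : nat -> {poly R}) (P : {poly R} -> Prop) :
  (forall n, size (b n) = n.+1) -> P 0 ->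
  (forall n x q, P q -> P (x *: b n + q)) -> forall p, P p.
Proof.
move=> sb P0 PD p; have [n] := ubnP (size p); elim: n p => // n IH p sp.
have [->//|p0] := eqVneq p 0.
pose d := (size p).-1; pose x := lead_coef p / lead_coef (b d).
have sd : size p = d.+1 by rewrite prednK // lt0n size_poly_eq0.
have b0 : lead_coef (b d) != 0 by rewrite lead_coef_eq0 -size_poly_eq0 sb.
have -> : p = x *: b d + (p - x *: b d) by rewrite addrC subrK.
apply/PD/IH; rewrite ltnS in sp; apply: (leq_trans _ sp).
rewrite sd ltnS; apply/leq_sizeP => j; rewrite leq_eqVlt => /orP[/eqP <-|dj].
  rewrite coefB coefZ; have -> : p`_d = lead_coef p by rewrite lead_coefE.
  have -> : (b d)`_d = lead_coef (b d) by rewrite lead_coefE sb.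
  by rewrite divfK // subrr.
by rewrite coefB coefZ !nth_default ?sb ?sd // mulr0 subrr.
Qed.

Section Functional.
Variables (R : numFieldType) (a : R).
Hypotheses (ha0 : a != 0) (ha1 : a != 1).
Implicit Types (c : R) (n r : nat) (rho : {scalar {poly R}}) (p : {poly R}).

(** Up to a constant factor, this equation characterizes the Meixner functional:
for a measure of weight w on the integers it reads a (x + c) w(x) =
(x + 1) w(x + 1).  It is used in place of
a representing measure. *)
Definition pearson c rho :=
  forall p, a * rho (('X + c%:P) * shift_op 1 p) = rho ('X * p).

(** The functional (X + c) (X + c + 1) ... (X + c + r - 1) rho, built one factor at
a time because each factor raises the Meixner parameter by one. *)
Fixpoint raised c rho r : {scalar {poly R}} :=
  if r is r'.+1 then raised (c + 1) (mul_functional ('X + c%:P) rho) r' else rho.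

Definition falling r : {poly R} := \prod_(i < r) ('X - i%:R%:P).

Lemma pearson_mul c rho :
  pearson c rho -> pearson (c + 1) (mul_functional ('X + c%:P) rho).
Proof.
move=> H p; have := H (('X + c%:P) * p).
rewrite /= /mul_functional shift_opM shift_opD shift_opX shift_opC mulr1z.
rewrite [('X + c%:P) * ('X * p)]mulrCA => <-; congr (_ * rho (_ * (_ * _))).
by rewrite polyCD polyC1; ring.
Qed.

Lemma pearson_raised r c rho : pearson c rho -> pearson (c + r%:R) (raised c rho r).
Proof.
elim: r c rho => [|r IH] c rho H; first by rewrite addr0.
by rewrite -natr1 addrCA addrC; apply/IH/pearson_mul.
Qed.

Lemma pearson_mass c rho : pearson c rho -> (1 - a) * rho ('X + c%:P) = c * rho 1.
Proof.
move=> /(_ 1); rewrite -polyC1 shift_opC polyC1 !mulr1 => H.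
have rc : rho c%:P = c * rho 1 by rewrite -alg_polyC linearZ.
by rewrite mulrBl mul1r H linearD rc addrC addKr.
Qed.

(** The Pearson equation at p = 1 gives (1 - a) rho(X + c) = c rho(1); this is
iterated r times. *)
Lemma raised_mass r c rho : pearson c rho ->
  (1 - a) ^+ r * raised c rho r 1 = (\prod_(i < r) (c + i%:R)) * rho 1.
Proof.
elim: r c rho => [|r IH] c rho H; first by rewrite big_ord0 expr0.
rewrite exprS -mulrA /= IH; last exact: pearson_mul.
rewrite /= /mul_functional mulr1 mulrCA pearson_mass // mulrA big_ord_recl addr0.
congr (_ * _); rewrite mulrC; congr (_ * _); apply: eq_bigr => i _.
by rewrite /= /bump add1n -natr1 addrCA addrC.
Qed.

(** The Pearson equation iterated r times. *)
Lemma pearson_falling r c rho p : pearson c rho ->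
  rho (falling r * p) = a ^+ r * raised c rho r (shift_op r%:Z p).
Proof.
elim: r c rho p => [|r IH] c rho p H.
  by rewrite /falling big_ord0 !mul1r shift_op0.
rewrite {1}/falling big_ord_recl subr0 -mulrA -H shift_opM.
have -> : shift_op 1 (\prod_(i < r) ('X - (lift ord0 i)%:R%:P)) = falling r.
  rewrite /shift_op rmorph_prod; apply: eq_bigr => i _.
  rewrite rmorphB /= comp_polyX comp_polyC /bump add1n -natr1 mulr1z polyCD.
  by rewrite polyC1; ring.
rewrite -[rho _]/(mul_functional ('X + c%:P) rho _) (IH (c + 1)); last exact: pearson_mul.
by rewrite shift_opA exprS mulrA -PoszD addn1.
Qed.

(** Discrete integration by parts: substitute the raising relation for m_{n+1} and
move the backward shift onto p by the Pearson equation. *)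
Lemma meixner_pairing_step c rho n p : pearson c rho ->
  n.+1%:R * rho (meixner a c n.+1 * p) =
  - mul_functional ('X + c%:P) rho (meixner a (c + 1) n * (shift_op 1 p - p)).
Proof.
move=> H; rewrite -linearZ /= scalerAl meixner_raise.
move: (meixner a (c + 1) n) => m.
have := H (shift_op (-1) m * p); rewrite shift_opM shift_opA subrr shift_op0 => Hm.
rewrite mulrBl linearB -scalerAl linearZ /= -['X * _ * p]mulrA -Hm mulKf //.
by rewrite /mul_functional !mulrBr linearB opprB !mulrA.
Qed.

Lemma meixner_orth n c rho p : pearson c rho -> (size p <= n)%N ->
  rho (meixner a c n * p) = 0.
Proof.
elim: n c rho p => [|n IH] c rho p H sp.
  by move: sp; rewrite leqn0 size_poly_eq0 => /eqP->; rewrite mulr0 linear0.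
apply: (mulfI (_ : n.+1%:R != 0)); first by rewrite pnatr_eq0.
rewrite meixner_pairing_step // IH ?oppr0 ?mulr0 //; first exact: pearson_mul.
by rewrite size_forward_difference; case: (size p) sp.
Qed.

Lemma meixner_norm n c rho p : (forall i : nat, c != - i%:R) ->
  pearson c rho -> rho 1 != 0 -> size p = n.+1 -> rho (meixner a c n * p) != 0.
Proof.
elim: n c rho p => [|n IH] c rho p hc H r1 sp.
  have p0 : p`_0 != 0.
    by have := size_poly_eq0 p; rewrite -lead_coef_eq0 lead_coefE sp /= => <-.
  rewrite meixner0 mul1r (size1_polyC (eq_leq sp)) -alg_polyC linearZ /=.
  by rewrite mulf_neq0.
have : n.+1%:R * rho (meixner a c n.+1 * p) != 0; last first.
  by rewrite mulf_eq0 negb_or => /andP[].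
rewrite meixner_pairing_step // oppr_eq0; apply: IH; last by rewrite size_forward_difference sp.
- by move=> i; rewrite -subr_eq0 opprK -addrA nat1r -[_.+1%:R]opprK subr_eq0.
- exact: pearson_mul.
rewrite /= /mul_functional mulr1; apply/eqP => z; have := pearson_mass H.
rewrite z mulr0 => /esym/eqP; rewrite mulf_eq0 (negPf r1) orbF.
by move: (hc 0); rewrite oppr0 => /negPf->.
Qed.

(** By the raising relation, rho(m_{n+1}) = 0 is the Pearson equation tested on a
translate of m_n^{a,c+1}, and these translates form a basis. *)
Lemma pearson_of_meixner c rho :
  (forall n, rho (meixner a c n.+1) = 0) -> pearson c rho.
Proof.
move=> H; suff T q : a * rho (('X + c%:P) * q) = rho ('X * shift_op (-1) q).
  by move=> p; rewrite T shift_opA addNr shift_op0.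
elim/(@poly_basis_ind _ (meixner a (c + 1))): q => [n||n x q IH].
- exact: size_meixner.
- by rewrite linear0 !mulr0 linear0 mulr0.
have := congr1 rho (meixner_raise a c n); rewrite linearZ /= H mulr0.
move: (meixner a (c + 1) n) => m.
rewrite linearB linearZ /= => /esym/subr0_eq Hm.
rewrite shift_opD shift_opZ !mulrDr !linearD /= mulrDr IH; congr (_ + _).
rewrite -!scalerAr !linearZ /= mulrCA; congr (_ * _).
by rewrite Hm mulVKf.
Qed.

End Functional.

(** * The masses of the translated polynomials *)

Section Orthogonality.
Variables (R : numFieldType) (a : R).
Hypotheses (ha0 : a != 0) (ha1 : a != 1).
Implicit Types (c x : R) (n k : nat) (rho : {scalar {poly R}}) (p : {poly R}).

Lemma mulX_pF k : 'X * pF R (iota 1 k) = falling R k.+1.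
Proof.
rewrite /falling big_ord_recl subr0 /pF; congr (_ * _).
have -> : iota 1 k = index_iota 1 k.+1 by rewrite /index_iota subn1.
by rewrite big_add1 big_mkord.
Qed.

Lemma pF_recr k :
  pF R (iota 1 k.+1) = falling R k.+1 - k.+1%:R *: pF R (iota 1 k).
Proof.
rewrite -mulX_pF -{1}[k.+1]addn1 iotaD /pF big_cat big_seq1 add1n /=.
by rewrite -mul_polyC; ring.
Qed.

(** The polynomial whose values at -1, -2, ... are, up to explicit factors, the
masses computed in [mass_translated_meixner]; as k grows its parameter decreases, so
that the forward difference of the one for k + 1 is a multiple of the one for
k. *)
Definition dual_meixner c k : {poly R} := meixner a (- c - k%:R + 1) k.

Lemma dual_meixner_at0 c k :
  k`!%:R * (dual_meixner c k).[0] = (-1) ^+ k * \prod_(i < k) (c + i%:R).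
Proof.
elim: k => [|k IH]; first by rewrite /dual_meixner meixner0 hornerC big_ord0.
have := meixner_at0 a (- c - k.+1%:R + 1) k.
have -> : - c - k.+1%:R + 1 + 1 = - c - k%:R + 1 by rewrite -natr1; ring.
rewrite -/(dual_meixner c k) -/(dual_meixner c k.+1).
have -> : - c - k.+1%:R + 1 = - (c + k%:R) by rewrite -natr1; ring.
move: (dual_meixner c k.+1).[0] (dual_meixner c k).[0] IH => w' w IH E.
rewrite factS natrM mulrAC E big_ord_recr exprS /=.
transitivity (- (c + k%:R) * (k`!%:R * w)); first by ring.
by rewrite IH; ring.
Qed.

Lemma dual_meixner_forward c k x :
  (dual_meixner c k.+1).[x + 1] - (dual_meixner c k.+1).[x] =
    (1 - a^-1) * (dual_meixner c k).[x].
Proof.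
rewrite /dual_meixner.
have -> : - c - k%:R + 1 = - c - k.+1%:R + 1 + 1 by rewrite -natr1; ring.
rewrite -hornerZ -meixner_forward.
by rewrite hornerD hornerN horner_shift_op mulr1z.
Qed.

(** Orthogonal for X p_F rho; for a positive weight rho on the natural numbers, X
p_F rho lives on the integers greater than k. *)
Definition translated_meixner c k n : {poly R} :=
  shift_op (- k.+1%:Z) (meixner a (c + k.+1%:R) n).

Lemma size_translated_meixner c k n : size (translated_meixner c k n) = n.+1.
Proof. by rewrite size_shift_op size_meixner. Qed.

Lemma translated_meixner_pascal c k n :
  translated_meixner c k n.+1 - a^-1 *: translated_meixner c k n =
  shift_op (- k%:Z) (meixner a (c + k%:R) n.+1).
Proof.
rewrite /translated_meixner -shift_opZ -shift_opB -natr1 addrA -meixner_pascal_l shift_opA.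
by congr shift_op; lia.
Qed.

(** Denote the left-hand side by u(k, n).  Replacing p_F for k + 1 by
X (X - 1) ... (X - k) - (k + 1) p_F, contiguity and the orthogonality of the
Meixner polynomials give
u(k+1, n+1) - a^{-1} u(k+1, n) = - (k + 1) u(k, n+1), and for n = 0 an explicit
inhomogeneous term appears.  The right-hand side satisfies the same recurrence
because of [dual_meixner_forward], and the same initial condition because of
[dual_meixner_at0]. *)
Lemma mass_translated_meixner c rho k n : pearson a c rho ->
  rho (pF R (iota 1 k) * translated_meixner c k n) =
  rho 1 * (k`!%:R * (a / (a - 1)) ^+ k) * a ^- n * (dual_meixner c k).[- n.+1%:R].
Proof.
move=> H; have a1 : a - 1 != 0 by rewrite subr_eq0.
have a1' : 1 - a != 0 by rewrite subr_eq0 eq_sym.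
elim: k n => [|k IHk] n.
  rewrite /pF big_nil mul1r /dual_meixner meixner0 hornerC fact0 expr0 !mulr1.
  elim: n => [|n IH]; first by rewrite /translated_meixner meixner0 -polyC1 shift_opC expr0 invr1 mulr1.
  have := translated_meixner_pascal c 0 n; rewrite oppr0 shift_op0 addr0 => /(canRL (subrK _)) ->.
  rewrite linearD [rho (a^-1 *: _)]linearZ /= IH -[meixner _ _ _]mulr1 meixner_orth ?size_poly1 //.
  by rewrite add0r exprS invfM mulrCA.
(* the decomposition of p_F, in which the first term is a Meixner pairing *)
have rec q : rho (pF R (iota 1 k.+1) * shift_op (- k.+1%:Z) q) =
    a ^+ k.+1 * raised c rho k.+1 q
      - k.+1%:R * rho (pF R (iota 1 k) * shift_op (- k.+1%:Z) q).
  rewrite pF_recr mulrBl linearB (pearson_falling _ _ H) shift_opA subrr shift_op0.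
  by rewrite -scalerAl linearZ.
have pr := pearson_raised k.+1 H.
have fac : (k.+1)`!%:R * (a / (a - 1)) ^+ k.+1 * (1 - a^-1) =
    k.+1%:R * (k`!%:R * (a / (a - 1)) ^+ k) :> R.
  by rewrite factS natrM exprS; field; rewrite ha0.
elim: n => [|n IH].
  have := rec (meixner a (c + k.+1%:R) 0); rewrite /translated_meixner !meixner0 -polyC1 !shift_opC polyC1 => ->.
  have := IHk 0; rewrite /translated_meixner meixner0 -polyC1 shift_opC polyC1 => ->.
  have -> : raised c rho k.+1 1 = (1 - a) ^- k.+1 * ((\prod_(i < k.+1) (c + i%:R)) * rho 1).
    by rewrite -(raised_mass k.+1 H) mulKf // expf_neq0.
  have := dual_meixner_forward c k (-1); rewrite addNr => /(canRL (subrK _)).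
  have := dual_meixner_at0 c k.+1; move: (\prod_(i < _) _) (_.[0]) => z w e.
  move=> E.
  have -> : (dual_meixner c k.+1).[- 1] = w - (1 - a^-1) * (dual_meixner c k).[- 1].
    by rewrite E; ring.
  rewrite expr0 invr1 !mulr1 -[1 *- 0.+1]/(-1).
  have T : (a / (a - 1)) ^+ k.+1 = (-1) ^+ k.+1 * (a ^+ k.+1 * (1 - a) ^- k.+1).
    have -> : a / (a - 1) = -1 * (a * (1 - a)^-1) by field; rewrite a1 a1'.
    by rewrite exprMn exprMn exprVn.
  transitivity (rho 1 * (a / (a - 1)) ^+ k.+1 * ((k.+1)`!%:R * w)
    - rho 1 * ((k.+1)`!%:R * (a / (a - 1)) ^+ k.+1 * (1 - a^-1)) * (dual_meixner c k).[-1]); last by ring.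
  rewrite e fac T; move: (dual_meixner c k).[_] ((a / _) ^+ k) (a ^+ _) ((1 - a) ^- _) => d t x y.
  transitivity (((-1) ^+ k.+1 * (-1) ^+ k.+1) * (rho 1 * (x * y) * z)
    - rho 1 * (k.+1%:R * (k`!%:R * t)) * d); last by ring.
  by rewrite -exprMn mulrNN mulr1 expr1n; ring.
have := translated_meixner_pascal c k.+1 n => /(canRL (subrK _)) ->.
rewrite mulrDr linearD.
have -> q : rho (pF R (iota 1 k.+1) * (a^-1 *: q)) = a^-1 * rho (pF R (iota 1 k.+1) * q).
  by rewrite -scalerAr linearZ.
rewrite rec -/(translated_meixner c k n.+1) IHk IH.
rewrite -[meixner a _ _]mulr1 meixner_orth // ?size_poly1 // mulr0 sub0r.
have := dual_meixner_forward c k (- n.+2%:R).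
have -> : - n.+2%:R + 1 = - n.+1%:R :> R by rewrite -natr1; ring.
move=> /(canRL (subrK _)) ->.
move: (dual_meixner c k.+1).[_] (dual_meixner c k).[_] => w z.
rewrite [a ^- n.+1](_ : _ = a^-1 * a ^- n); last by rewrite exprS invfM.
move: ((a / _) ^+ k.+1) ((a / _) ^+ k) (a ^- n) fac => T t u fac.
transitivity (rho 1 * (a^-1 * u) * ((k.+1)`!%:R * T * (1 - a^-1) * z
  - k.+1%:R * (k`!%:R * t) * z + (k.+1)`!%:R * T * w)); first by ring.
by rewrite fac; ring.
Qed.

End Orthogonality.

(** * The orthogonal polynomials *)

(** After subtracting the multiple with the same leading term, what remains has
degree d < n and is orthogonal to all lower powers, hence to Q_d; expanding that
pairing the other way gives its leading coefficient times the norm of Q_d. *)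
Lemma orthogonal_polys_unique (R : fieldType) (mu : {scalar {poly R}})
    (q Q : nat -> {poly R}) :
  is_orthogonal_polys mu q -> is_orthogonal_polys mu Q ->
  forall n, exists x, q n = x *: Q n.
Proof.
move=> oq oQ n; have [sq q0 _] := oq n; have [sQ Q0 _] := oQ n.
have Qn0 : lead_coef (Q n) != 0 by rewrite lead_coef_eq0 -size_poly_eq0 sQ.
exists (lead_coef (q n) / lead_coef (Q n)); apply/eqP; rewrite -subr_eq0.
move: (_ / _) (divfK Qn0 (lead_coef (q n))) => x ex; set r : {poly R} := _ - _.
have sr : (size r <= n)%N.
  apply/leq_sizeP => j; rewrite leq_eqVlt => /orP[/eqP <-|nj].
    have -> : n = (size (Q n)).-1 by rewrite sQ.
    rewrite coefB coefZ -/(lead_coef (Q n)) ex lead_coefE sQ sq /=.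
    by rewrite subrr.
  by rewrite coefB coefZ !nth_default ?sq ?sQ // mulr0 subrr.
have r0 m : (m < n)%N -> mu (r * 'X^m) = 0.
  by move=> mn; rewrite mulrBl linearB -scalerAl linearZ /= q0 // Q0 // mulr0 subrr.
(* orthogonality to the powers below size p extends to p by linearity *)
have mulow (p s : {poly R}) : (forall m, (m < size p)%N -> mu (s * 'X^m) = 0) -> mu (s * p) = 0.
  move=> H; rewrite -[p]coefK poly_def mulr_sumr linear_sum big1 // => i _.
  by rewrite /= -scalerAr linearZ /= H ?mulr0 // -{2}[p]coefK size_poly.
have [//|rn0] := eqVneq r 0.
have [d sr0] : exists d, size r = d.+1.
  by exists (size r).-1; rewrite prednK // lt0n size_poly_eq0.
have [sd Qd Nd] := oQ d.
have er : r = \sum_(i < d.+1) r`_i *: 'X^i by rewrite -sr0 -poly_def coefK.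
have : mu (Q d * r) = lead_coef r * mu (Q d * 'X^d).
  rewrite {1}er big_ord_recr mulrDr linearD /= mulr_sumr linear_sum big1 => [|i _].
    by rewrite add0r -scalerAr linearZ /= lead_coefE sr0.
  by rewrite /= -scalerAr linearZ /= Qd ?mulr0.
rewrite [Q d * r]mulrC (mulow (Q d) r) => [/esym/eqP|m].
  by rewrite mulf_eq0 lead_coef_eq0 (negPf rn0) (negPf Nd).
by rewrite sd -sr0 => /leq_trans /(_ sr); apply: r0.
Qed.

Section Krall.
Variables (R : numFieldType) (a : R).
Hypotheses (ha0 : a != 0) (ha1 : a != 1).
Variables (c : R) (k : nat).
Hypothesis hc : forall i : nat, c != - i%:R.
Hypothesis hm : forall n : nat, (1 <= n)%N -> (dual_meixner a c k).[- n%:R] != 0.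

Local Notation P := (translated_meixner a c k).
Local Notation Y n := ((dual_meixner a c k).[- n%:R]).

(** Every combination of P_n and P_{n-1} pairs to zero with X, ..., X^{n-1}; these
coefficients are the ones for which the masses computed in
[mass_translated_meixner] cancel as well.  Here Y n stands for a value at -n, so
it is the number called Y(n-1) in the introduction. *)
Definition krall_meixner n : {poly R} :=
  Y n *: P n - (a^-1 * Y n.+1) *: (if n is m.+1 then P m else 0).

(** The value at 0 is the only one not covered by the hypothesis hm: it is a multiple
of c (c + 1) ... (c + k - 1). *)
Lemma dual_meixner_neq0 n : Y n != 0.
Proof.
case: n => [|n]; last exact: hm.
have : k`!%:R * (dual_meixner a c k).[0] != 0.
  rewrite dual_meixner_at0 // mulf_eq0 signr_eq0 prodf_seq_neq0 /=.
  by apply/allP => i _ /=; rewrite addr_eq0.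
by rewrite mulf_eq0 negb_or oppr0 => /andP[].
Qed.

Lemma size_krall_meixner n : size (krall_meixner n) = n.+1.
Proof.
rewrite /krall_meixner size_polyDl ?size_scale ?dual_meixner_neq0 ?size_translated_meixner //.
rewrite size_polyN; apply: leq_ltn_trans (size_scale_leq _ _) _.
by case: n => [|n]; rewrite ?size_poly0 ?size_translated_meixner.
Qed.

Section Functional.
Variable rho : {scalar {poly R}}.
Hypotheses (H : pearson a c rho) (r1 : rho 1 != 0).

(** Pairing P_n for X p_F rho is pairing a Meixner polynomial for the functional of
parameter c + k + 1. *)
Lemma translated_meixner_pairing n p :
  rho ('X * pF R (iota 1 k) * (P n * p)) =
  a ^+ k.+1 * raised c rho k.+1 (meixner a (c + k.+1%:R) n * shift_op k.+1%:Z p).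
Proof.
by rewrite mulX_pF (pearson_falling _ _ H) shift_opM shift_opA subrr shift_op0.
Qed.

Lemma krall_meixner_orth :
  is_orthogonal_polys (mul_functional (pF R (iota 1 k)) rho) krall_meixner.
Proof.
have pr := pearson_raised k.+1 H.
have hck i : c + k.+1%:R != - i%:R.
  by rewrite -subr_eq0 opprK -addrA -natrD addr_eq0.
have rn : raised c rho k.+1 1 != 0.
  have := raised_mass k.+1 H => e; apply: contra_neq (_ : (\prod_(i < k.+1) (c + i%:R)) * rho 1 != 0).
    by move=> z; rewrite -e z mulr0.
  rewrite mulf_neq0 // prodf_seq_neq0; apply/allP => i _ /=; by rewrite addr_eq0.
have orth n m : (m < n)%N -> rho ('X * pF R (iota 1 k) * (P n * 'X^m)) = 0.
  move=> mn; rewrite translated_meixner_pairing meixner_orth ?mulr0 //.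
  by rewrite size_shift_op size_polyXn.
have expand n m : mul_functional (pF R (iota 1 k)) rho (krall_meixner n.+1 * 'X^m) =
   Y n.+1 * rho (pF R (iota 1 k) * (P n.+1 * 'X^m))
   - a^-1 * Y n.+2 * rho (pF R (iota 1 k) * (P n * 'X^m)).
  rewrite /krall_meixner /mul_functional; move: (P n.+1) (P n) => p q.
  by rewrite mulrBl mulrBr linearB -!scalerAl -!scalerAr !linearZ.
have pX (p : {poly R}) m : pF R (iota 1 k) * (p * 'X^(m.+1)) = 'X * pF R (iota 1 k) * (p * 'X^m).
  by rewrite exprS; ring.
case=> [|n]; split; rewrite ?size_krall_meixner //.
  rewrite /krall_meixner scaler0 subr0 expr0 mulr1 linearZ /= /mul_functional.
  rewrite mass_translated_meixner // expr0 invr1 mulr1.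
  have a1 : a / (a - 1) != 0 by rewrite mulf_neq0 // invr_eq0 subr_eq0.
  by rewrite !mulf_neq0 ?dual_meixner_neq0 ?expf_neq0 ?pnatr_eq0 -?lt0n ?fact_gt0.
case=> [_|m mn].
  rewrite /= expand expr0 !mulr1 !mass_translated_meixner //.
  have -> : a ^- n.+1 = a^-1 * a ^- n by rewrite exprS invfM.
  by ring.
  by rewrite /= expand !pX !orth ?mulr0 ?subrr // ltnW.
rewrite /= expand !pX orth // mulr0 sub0r oppr_eq0 translated_meixner_pairing.
rewrite !mulf_neq0 ?invr_eq0 ?dual_meixner_neq0 ?expf_neq0 //.
by apply: meixner_norm => //; rewrite size_shift_op size_polyXn.
Qed.

End Functional.
End Krall.

(** * Difference operators and polynomials in them *)

Section DifferenceOperators.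
Variable R : numFieldType.
Implicit Types (p q : {poly R}) (f : int -> {poly R}) (l : int) (m n : nat).

(** The coefficients are a function on all integers, so that composition with a
shift is a translation of f; the window of summation only needs to contain the
support of f. *)
Definition diffop m f p : {poly R} :=
  \sum_(i < (2 * m).+1) f (- m%:Z + i%:Z) * shift_op (- m%:Z + i%:Z) p.

Definition supported m f := forall l, (m < `|l|)%N -> f l = 0.

Fact diffop_is_linear m f : linear (diffop m f).
Proof.
move=> x p q; rewrite /diffop scaler_sumr -big_split; apply: eq_bigr => i _ /=.
by rewrite shift_opD shift_opZ mulrDr scalerAr.
Qed.
HB.instance Definition _ m f :=
  GRing.isLinear.Build R {poly R} {poly R} *:%R (diffop m f) (diffop_is_linear m f).

Lemma diffopD m f g p :
  diffop m (fun l => f l + g l) p = diffop m f p + diffop m g p.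
Proof. by rewrite /diffop -big_split; apply: eq_bigr => i _; rewrite mulrDl. Qed.

Lemma diffopM m q f p : diffop m (fun l => q * f l) p = q * diffop m f p.
Proof. by rewrite /diffop mulr_sumr; apply: eq_bigr => i _; rewrite mulrA. Qed.

Lemma diffop_widen m f p : supported m f -> diffop m.+1 f p = diffop m f p.
Proof.
move=> s; rewrite /diffop mulnS !addSn add0n big_ord_recl big_ord_recr /=.
rewrite !s ?mul0r ?addr0 ?add0r; [|rewrite /bump /=; lia|lia].
by apply: eq_bigr => i _; congr (f _ * shift_op _ _); rewrite /bump /=; lia.
Qed.

Lemma shift_diffop_up m f p : supported m f ->
  shift_op 1 (diffop m f p) = diffop m.+1 (fun l => shift_op 1 (f (l - 1))) p.
Proof.
move=> s; rewrite /diffop mulnS !addSn add0n [RHS]big_ord_recl [X in _ = _ + X]big_ord_recl /=.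
rewrite !s ?linear0 ?mul0r ?add0r; [|rewrite /bump /=; lia..].
rewrite linear_sum; apply: eq_bigr => i _ /=.
by rewrite shift_opM shift_opA; congr (shift_op _ (f _) * shift_op _ _); rewrite /bump /=; lia.
Qed.

Lemma shift_diffop_down m f p : supported m f ->
  shift_op (-1) (diffop m f p) = diffop m.+1 (fun l => shift_op (-1) (f (l + 1))) p.
Proof.
move=> s; rewrite /diffop mulnS !addSn add0n [RHS]big_ord_recr [X in _ = X + _]big_ord_recr /=.
rewrite ![in RHS](s (_ + 1)) ?linear0 ?mul0r ?addr0; [|lia|lia].
rewrite linear_sum; apply: eq_bigr => i _ /=.
by rewrite shift_opM shift_opA; congr (shift_op _ (f _) * shift_op _ _); lia.
Qed.

Lemma diffop_const m q p : diffop m (fun l => if l == 0 then q else 0) p = q * p.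
Proof.
elim: m => [|m <-]; first by rewrite /diffop big_ord1 shift_op0.
by apply: diffop_widen => l; case: eqP => // ->.
Qed.

Variables (g1 g0 gm : {poly R}).
Hypotheses (s1 : size g1 = 2) (sm : size gm = 2).

(** With N = g1 s_1 + g0 + gm s_{-1} and F of degree n, the operator F(N), built by
the Horner scheme F = F1 X + c.  Composition with N multiplies translates of the two
extreme coefficients by g1 and gm, which raises their degrees by one; only these degrees are recorded,
as they suffice to exclude cancellation in
[krall_operator]. *)
Lemma diffop_horner n (F : {poly R}) : size F = n.+1 ->
  exists f, [/\ supported n f, size (f n%:Z) = n.+1, size (f (- n%:Z)) = n.+1 &
    forall p x, g1 * shift_op 1 p + g0 * p + gm * shift_op (-1) p = x *: p ->
      diffop n f p = F.[x] *: p].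
Proof.
elim: n F => [|n IH] F.
  move=> sF; have F0 : F`_0 != 0.
    by have := size_poly_eq0 F; rewrite -lead_coef_eq0 lead_coefE sF /= => <-.
  exists (fun l => if l == 0 then (F`_0)%:P else 0); split.
  - by move=> l; case: eqP => // ->.
  - by rewrite size_polyC F0.
  - by rewrite size_polyC F0.
  by move=> p x _; rewrite diffop_const {2}(size1_polyC (eq_leq sF)) hornerC mul_polyC.
elim/poly_ind: F => [|F c _]; first by rewrite size_poly0.
rewrite size_MXaddC; case: ifP => // _ [] /IH [f [sf fn fN fE]].
exists (fun l => g1 * shift_op 1 (f (l - 1)) + g0 * f l
   + gm * shift_op (-1) (f (l + 1)) + (if l == 0 then c%:P else 0)); split.
- move=> l hl; rewrite !sf; [|lia|lia|lia].
  rewrite !linear0 !mulr0 !add0r; case: eqP => // l0; by move: hl; rewrite l0.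
- rewrite (sf n.+1) ?(sf (n.+1%:Z + 1)); [|lia|lia].
  rewrite !linear0 !mulr0 !addr0 /=; have -> : n.+1%:Z - 1 = n by lia.
  by rewrite size_mul -?size_poly_eq0 ?size_shift_op ?s1 ?fn.
- rewrite (sf (- n.+1%:Z)) ?(sf (- n.+1%:Z - 1)); [|lia|lia].
  rewrite !linear0 !mulr0 !add0r; have -> : - n.+1%:Z + 1 = - n%:Z by lia.
  have -> : (- n.+1%:Z == 0) = false by lia.
  by rewrite addr0 size_mul -?size_poly_eq0 ?size_shift_op ?sm ?fN.
move=> p x Np; rewrite !diffopD !diffopM -shift_diffop_up // -shift_diffop_down //.
rewrite diffop_widen // diffop_const (fE _ _ Np) hornerMXaddC.
rewrite !shift_opZ -!scalerAr -!scalerDr Np scalerA scalerDl mul_polyC //.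
Qed.

End DifferenceOperators.

(** * The operator *)

Section KrallOperator.
Variables (R : numFieldType) (a : R).
Hypotheses (ha0 : a != 0) (ha1 : a != 1).
Variables (c : R) (k : nat).

Local Notation P := (translated_meixner a c k).
Local Notation Y n := ((dual_meixner a c k).[- n%:R]).

Lemma translated_meixner_eigen n :
  (a / (a - 1)) *: ('X + c%:P) * shift_op 1 (P n)
  - ((a / (a - 1)) *: ('X + c%:P) + (a - 1)^-1 *: ('X - k.+1%:R%:P)) * P n
  + (a - 1)^-1 *: ('X - k.+1%:R%:P) * shift_op (-1) (P n) = n%:R *: P n.
Proof.
have a1 : a - 1 != 0 by rewrite subr_eq0.
have := congr1 (shift_op (- k.+1%:Z)) (meixner_eigen ha0 (c + k.+1%:R) n).
rewrite /translated_meixner; move: (meixner _ _ n) => m.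
rewrite shift_opB !shift_opM !shift_opZ !shift_opB !shift_opA.
rewrite [- _ + 1]addrC [- _ - 1]addrC -!shift_opA shift_opD shift_opX shift_opC.
move: (shift_op _ m) => p; rewrite mulrNz -[k.+1%:~R]/(k.+1%:R) polyCD polyCN.
have -> : n%:R *: p = (a - 1)^-1 *: (((a - 1) * n%:R) *: p) by rewrite scalerA mulKf.
move=> <-.
rewrite -!mul_polyC polyCM; ring.
Qed.

(** By the two Pascal relations both sides are m_{n+1}^{a,c+k}(x - k - 1). *)
Lemma translated_meixner_lower n :
  shift_op (-1) (P n.+1 - a^-1 *: P n) = P n.+1 - P n.
Proof.
rewrite translated_meixner_pascal // shift_opA /translated_meixner -shift_opB.
have -> : - 1 - k%:Z = - k.+1%:Z by lia.
by rewrite -natr1 addrA -meixner_pascal_r.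
Qed.

(** The operator is G(N) + E Y(N), where Y(n) and G(n) are the values of the dual
polynomials of degrees k and k + 1 at -n-1, the latter multiplied by
a / (a - 1), and E = (s_{-1} - a) / (1 - a).  The relation G(n) + Y(n) = G(n-1)
that makes Q_n an eigenfunction is [dual_meixner_forward]. *)
Lemma krall_operator : exists f : int -> {poly R},
  [/\ f (- k.+1%:Z) != 0, f k.+1%:Z != 0 &
   forall n, diffop k.+1 f (krall_meixner a c k n) =
     (a / (a - 1) * (dual_meixner a c k.+1).[- n%:R]) *: krall_meixner a c k n].
Proof.
have a1 : a - 1 != 0 by rewrite subr_eq0.
have a2 : 1 - a != 0 by rewrite subr_eq0 eq_sym.
have sg1 : size ((a / (a - 1)) *: ('X + c%:P)) = 2.
  by rewrite size_scale ?size_XaddC // mulf_neq0 // invr_eq0.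
have sgm : size ((a - 1)^-1 *: ('X - k.+1%:R%:P)) = 2.
  by rewrite size_scale ?size_XsubC // invr_eq0.
have sr j : size (dual_meixner a c j \Po (- 'X - 1)) = j.+1.
  rewrite size_comp_poly2 ?size_meixner //.
  by rewrite -opprD size_polyN -polyC1 size_XaddC.
have er j n : (dual_meixner a c j \Po (- 'X - 1)).[n%:R] = (dual_meixner a c j).[- n.+1%:R].
  by rewrite horner_comp hornerD !hornerN hornerX hornerC -opprD natr1.
have sF : size ((a / (a - 1)) *: (dual_meixner a c k.+1 \Po (- 'X - 1))) = k.+2.
  by rewrite size_scale ?sr // mulf_neq0 // invr_eq0.
pose g0 := - ((a / (a - 1)) *: ('X + c%:P) + (a - 1)^-1 *: ('X - k.+1%:R%:P)).
have [fP [sfP fP1 fPm fPE]] := diffop_horner g0 sg1 sgm sF.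
have [fY [sfY fY1 fYm fYE]] := diffop_horner g0 sg1 sgm (sr k).
exists (fun l => fP l + (((1 - a)^-1)%:P * shift_op (-1) (fY (l + 1))
   + (- (a / (1 - a)))%:P * fY l)); split.
- rewrite (sfY (- k.+1%:Z)); last by lia.
  have -> : - k.+1%:Z + 1 = - k%:Z by lia.
  rewrite mulr0 addr0 -size_poly_eq0 size_polyDl ?fPm // mul_polyC.
  by rewrite size_scale ?invr_eq0 // size_shift_op fYm.
- rewrite !sfY; [|lia|lia].
  by rewrite linear0 !mulr0 !addr0 -size_poly_eq0 fP1.
have N n : (a / (a - 1)) *: ('X + c%:P) * shift_op 1 (P n) + g0 * P n
   + (a - 1)^-1 *: ('X - k.+1%:R%:P) * shift_op (-1) (P n) = n%:R *: P n.
  by rewrite mulNr translated_meixner_eigen.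
have EP n := fPE _ _ (N n); have EY n := fYE _ _ (N n).
(* G(n) + Y(n) = G(n-1) *)
have step n : a / (a - 1) * (dual_meixner a c k.+1).[- n.+1%:R] + Y n.+1 =
    a / (a - 1) * (dual_meixner a c k.+1).[- n%:R].
  have := dual_meixner_forward a c k (- n.+1%:R).
  have -> : - n.+1%:R + 1 = - n%:R :> R by rewrite -natr1; ring.
  by move=> /(canRL (subrK _)) ->; field; rewrite ha0.
move=> n; rewrite !diffopD !diffopM -shift_diffop_down // (diffop_widen _ sfY).
rewrite /krall_meixner; set p : {poly R} := (if n is m.+1 then P m else 0).
have pP : diffop k.+1 fP p = (a / (a - 1) * (dual_meixner a c k.+1).[- n%:R]) *: p.
  by rewrite /p; case: (n) => [|m]; [rewrite linear0 scaler0|rewrite EP hornerZ er].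
have pY : diffop k fY p = Y n *: p.
  by rewrite /p; case: (n) => [|m]; [rewrite linear0 scaler0|rewrite EY er].
have pL : shift_op (-1) (P n - a^-1 *: p) = P n - p.
  rewrite /p; case: (n) => [|m]; last exact: translated_meixner_lower.
  by rewrite scaler0 !subr0 /translated_meixner meixner0 -polyC1 !shift_opC.
move: (EP n) (EY n) (step n) pP pY pL; rewrite hornerZ !er.
move: (P n) p => u v EPn EYn stepn pP pY pL.
have lin m h x y : diffop m h (x *: u - y *: v) = x *: diffop m h u - y *: diffop m h v.
  by rewrite linearB !linearZ.
rewrite !lin. rewrite EPn EYn pP pY.
have -> : Y n *: (Y n.+1 *: u) - (a^-1 * Y n.+1) *: (Y n *: v) =
    (Y n * Y n.+1) *: (u - a^-1 *: v).
  by rewrite -!mul_polyC !polyCM; ring.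
rewrite shift_opZ pL.
(* E undoes the lowering P_n - a^-1 P_{n-1}, as in [translated_meixner_lower] *)
have -> : ((1 - a)^-1)%:P * ((Y n * Y n.+1) *: (u - v)) +
    (- (a / (1 - a)))%:P * ((Y n * Y n.+1) *: (u - a^-1 *: v)) = (Y n * Y n.+1) *: u.
  move: (Y n * Y n.+1) => K.
  have -> : - (a / (1 - a)) = 1 - (1 - a)^-1 by field.
  have rel : (1 - (1 - a)^-1) * a^-1 = - (1 - a)^-1 by field; rewrite a2.
  rewrite !mul_polyC !scalerBr !scalerA.
  rewrite [_ * K / a]mulrAC rel mulNr scaleNr opprK mulrBl mul1r scalerBl.
  by ring.
rewrite -stepn; move: (dual_meixner a c k.+1).[_] (Y n) (Y n.+1) => x y z.
by rewrite -!mul_polyC !(polyCM, polyCD); ring.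
Qed.

End KrallOperator.

(** * The eigenvalue equation *)

Theorem corollary5p8 (R : realType) (k : nat) (a c : R)
    (rho : {scalar {poly R}})
    (hk : (0 < k)%N)
    (ha0 : a != 0) (ha1 : a != 1)
    (hc : forall i : nat, c != - i%:R)
    (hm : forall n : nat, (1 <= n)%N ->
            (meixner a (- c - k%:R + 1) k).[- n%:R] != 0)
    (hrho : is_meixner_functional a c rho) :
  (exists q : nat -> {poly R},
      is_orthogonal_polys (mul_functional (pF R (iota 1 k)) rho) q) /\
  (forall q : nat -> {poly R},
      is_orthogonal_polys (mul_functional (pF R (iota 1 k)) rho) q ->
      exists (D : {poly R} -> {poly R}) (lambda : nat -> R),
        [/\ is_diffop_of_order D (2 * k + 2),
            is_diffop_of_genre D (- k%:Z - 1) (k%:Z + 1) &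
            forall n : nat, D (q n) = lambda n *: q n]).
Proof.
have [orho _] := hrho.
have pr : pearson a c rho.
  apply: pearson_of_meixner => // n; have [_ /(_ 0 isT)] := orho n.+1.
  by rewrite expr0 mulr1.
have r1 : rho 1 != 0.
  by have [_ _] := orho 0; rewrite meixner0 expr0 mulr1.
have oQ := krall_meixner_orth ha0 ha1 hc hm pr r1.
split; first by exists (krall_meixner a c k).
move=> q oq; have [f [fm f1 fE]] := krall_operator ha0 ha1 c k.
have genre : is_diffop_of_genre (diffop k.+1 f) (- k%:Z - 1) (k%:Z + 1).
  have -> : - k%:Z - 1 = - k.+1%:Z by lia.
  have -> : k%:Z + 1 = k.+1%:Z by lia.
  split; first by lia.
  exists f; split=> // p.
  by have -> : `|k.+1%:Z - - k.+1%:Z|%N = (2 * k.+1)%N by lia.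
exists (diffop k.+1 f), (fun n => a / (a - 1) * (dual_meixner a c k.+1).[- n%:R]).
split=> //; first by exists (- k%:Z - 1), (k%:Z + 1); split=> //; lia.
move=> n; have [x ->] := orthogonal_polys_unique oq oQ n.
by rewrite linearZ /= fE !scalerA mulrC.
Qed.
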